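(* Let $p$ be an odd prime number, and let $i$, $k_1$ and $k_2$ be positive integers with $1 \leq k_1, k_2 \leq p-1$. Put $d_2 = k_2 p^i + k_1$ and $d_3 = k_2 p^{2i} + (p-1)p^i + k_1$. (i) The monomial $f_{d_2}(x) = x^{d_2}$ is a $p$-exceptional GAPN function if and only if $w_p(d_2) \geq p$ and $\gcd(d_2, p-1) = 1$. (ii) The monomial $f_{d_3}(x) = x^{d_3}$ is a $p$-exceptional GAPN function if $w_p(d_3) < 2(p-1)$ and $\gcd(d_3, p-1) = 1$.
   Context: For a non-negative integer $m$ with $p$-adic expansion $m=\sum_{s\ge 0}c_s(m)p^s$ ($0\le c_s(m)\le p-1$), the $p$-weight is $w_p(m)=\sum_{s\ge0}c_s(m)$. A function $f\colon \mathbb{F}_{p^n}\to\mathbb{F}_{p^n}$ is a generalized almost perfect nonlinear (GAPN) function if for all $a\in\mathbb{F}_{p^n}^{\times}$ and all $b\in\mathbb{F}_{p^n}$, $\#\{x\in\mathbb{F}_{p^n} \mid \sum_{j\in\mathbb{F}_p} f(x+ja)=b\}\le p$. A polynomial $f\in\mathbb{F}_p[x]$ is a $p$-exceptional GAPN function if the function it induces on $\mathbb{F}_{p^n}$ is GAPN for infinitely many positive integers $n$. *)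

(* Defs.v *)
From HB Require Import structures.
From mathcomp Require Import all_boot all_order all_algebra all_field.

Set Implicit Arguments.
Unset Strict Implicit.
Unset Printing Implicit Defensive.

Import GRing.Theory.
Local Open Scope ring_scope.

(* For p > 1 and s >= m the digit of index s of m is 0, since m < p ^ m; hence
   the sum over s < m collects all the nonzero digits. *)
Definition p_weight (p m : nat) : nat := (\sum_(s < m) (m %/ p ^ s) %% p)%N.

(* This is the canonical embedding when F has prime characteristic p. *)
Definition Fp_embed (p : nat) (F : nzRingType) (c : 'F_p) : F :=
  (c : nat)%:R.

Definition GAPN (p : nat) (F : finFieldType) (f : F -> F) : Prop :=
  forall a b : F, a != 0 ->
    (#|[set x : F | (\sum_(j : 'F_p) f (x + Fp_embed F j * a) == b)%R]| <= p)%N.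

Definition induced (p : nat) (F : finFieldType) (f : {poly 'F_p}) (x : F) : F :=
  (map_poly (@Fp_embed p F) f).[x].

(* A field with p ^ n elements exists for every prime p and n > 0
   (PrimePowerField) and is unique up to isomorphism, so quantifying over all of
   them amounts to fixing one; n = 0 is excluded by N < n. *)
Definition p_exceptional_GAPN (p : nat) (f : {poly 'F_p}) : Prop :=
  forall N : nat, exists2 n : nat, (N < n)%N &
    forall F : finFieldType, #|F| = (p ^ n)%N -> @GAPN p F (induced f).

(* Main.v *)
Require Import Defs.
From HB Require Import structures.
From mathcomp Require Import all_boot all_order all_algebra all_field.
From mathcomp Require Import cyclic ring.

(** Let $F$ be a field with $p^n$ elements and
    $S_d(y) = \sum_{c \in F_p} (y + c)^d$.  Rescaling the direction $a$ to $1$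
    shows that $x^d$ is GAPN on $F$ exactly when every fibre of $S_d$ has at
    most $p$ elements ([GAPN_XnP]).

    Since $(y+c)^{p^i} = y^{p^i} + c$, the function $S_d$ is a sum
    $\sum_c P(x + c)$ with $P$ a product of powers of linear polynomials, one
    for each nonzero digit of $d$.  The key fact [sum_horner_Fp] is that for
    $\deg P \le 2(p-1)$ this sum does not depend on the base point $x$: it is
    minus the sum of the coefficients of $P$ at $X^{p-1}$ and $X^{2(p-1)}$.
    With a suitable base point ($y$ for two digits, $y^{p^i}$ for three) the
    coefficients can be read off, and for $z = y^{p^i} - y$ one finds
    - $S_{d_2}(y) = \alpha z^{k_1+k_2-(p-1)} + \beta$ when
      $k_1 + k_2 \ge p-1$, with $\alpha$ a nonzero binomial coefficient modulo
      $p$, and $S_{d_2}$ is constant when $k_1 + k_2 \le p-1$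
      ([Fp_sum_2digits]);
    - $S_{d_3}(y) = \pm z^{k_2 p^i + k_1}$ when $k_1 + k_2 < p-1$
      ([Fp_sum_3digits]).

    Sufficiency ([p_exceptional_of_Fp_sum]): in both cases
    $S_d = \alpha z^M + \beta$ with $\alpha \ne 0$, $M > 0$ and
    $\gcd(M, p-1) = \gcd(d, p-1) = 1$, because $p^i \equiv 1$ modulo $p-1$.
    Let $n$ be any prime exceeding $i$ and $M$.  Then
    $\gcd(M, p^n-1) = 1$, so that $z \mapsto z^M$ is injective on $F$, and
    $\gcd(i, n) = 1$, so that the additive map $y \mapsto y^{p^i} - y$ has
    kernel $F_p$.  The fibres of $S_d$ thus have at most $p$ elements.

    Necessity, for any single field with more than $p$ elements: a constant
    $S_d$ has a fibre that is too large, which forces $k_1 + k_2 \ge p$.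
    If $\gcd(d, p-1) > 1$, some $\zeta \ne 1$ in $F_p^*$ satisfies
    $\zeta^d = 1$; then $S_d(\zeta y) = S_d(y) = S_d(y+c)$, and for $y$ outside
    $F_p$ the point $\zeta y$ together with the $p$ points $y + c$ lies in one
    fibre ([GAPN_monomial_coprime]). *)

(** * Arithmetic of binomial coefficients and of $p^n - 1$ *)

(** Lucas: adding $p-1$ and $i$ in base $p$ produces a carry.  Concretely,
    $p\binom{m}{p} = (m-p+1)\binom{m}{p-1}$ with $m-p+1 = i$ prime to $p$. *)
Lemma prime_dvd_bin_pred p i : prime p -> 0 < i <= p.-1 ->
  p %| 'C(p.-1 + i, p.-1).
Proof.
move=> p_pr /andP[i0 ip].
have /(congr1 (dvdn p)) := mul_bin_left (p.-1 + i) p.-1.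
rewrite prednK ?prime_gt0 // dvdn_mulr // addKn Euclid_dvdM //.
by rewrite [p %| i]gtnNdvd ?(leq_ltn_trans ip) //= ?prednK ?prime_gt0.
Qed.

Lemma prime_ndvd_bin p n k : prime p -> k <= n < p -> ~~ (p %| 'C(n, k)).
Proof.
move=> p_pr /andP[kn np]; apply/negP => dvdC.
have ndvd_fact : ~~ (p %| n`!).
  elim: n np {kn dvdC} => [|n IH] np.
    by rewrite dvdn1 gtn_eqF // prime_gt1.
  by rewrite factS Euclid_dvdM // gtnNdvd //= IH // ltnW.
by move/negP: ndvd_fact; apply; rewrite -(bin_fact kn) dvdn_mulr.
Qed.

(** A prime $l \le M \le n$ dividing $p^n-1$ would make the order of $p$ modulo
    $l$ divide both $n$ and $l-1 < n$; as $n$ is prime this order is $1$, so $l$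
    divides $p-1$. *)
Lemma coprime_pred_expn p n M : 1 < p -> prime n -> 0 < M <= n ->
  coprime M p.-1 -> coprime M (p ^ n).-1.
Proof.
move=> p1 n_pr /andP[M0 Mn] coM; apply/negPn/negP => ncop.
have pn1 : 1 < p ^ n by rewrite -(exp1n n) ltn_exp2r ?prime_gt0.
pose g := gcdn M (p ^ n).-1.
have g1 : 1 < g by rewrite ltn_neqAle eq_sym ncop gcdn_gt0 M0.
have l_pr : prime (pdiv g) by rewrite pdiv_prime.
have [lM lpn] : pdiv g %| M /\ pdiv g %| (p ^ n).-1.
  by split; apply: dvdn_trans (pdiv_dvd g) _; rewrite ?dvdn_gcdl ?dvdn_gcdr.
move: (pdiv g) l_pr lM lpn => l l_pr lM lpn.
have pnl : p ^ n = 1 %[mod l].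
  by apply/eqP; rewrite eqn_mod_dvd ?subn1 // ltnW.
have col : coprime p l.
  rewrite coprime_sym prime_coprime //; apply: contraL lpn => lp.
  rewrite -subn1 dvdn_subr ?(ltnW pn1) ?dvdn_exp ?prime_gt0 //.
  by rewrite gtnNdvd ?prime_gt1.
have := Euler_exp_totient col; rewrite totient_prime // => pll.
have l1 : 0 < l.-1 by rewrite -ltnS prednK ?prime_gt0 ?prime_gt1.
have /eqP con : coprime n l.-1.
  rewrite prime_coprime // gtnNdvd // (leq_trans _ Mn) //.
  by rewrite (leq_trans _ (dvdn_leq M0 lM)) // prednK ?prime_gt0.
have [a b + _] := egcdnP l.-1 (prime_gt0 n_pr); rewrite con => bez.
have : p = 1 %[mod l].
  have <- : p ^ (a * n) = 1 %[mod l].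
    by rewrite mulnC expnM -modnXm pnl modnXm exp1n.
  rewrite bez addn1 expnS (mulnC b) expnM -modnMmr -modnXm pll.
  by rewrite modnXm exp1n modnMmr muln1.
move/eqP; rewrite eqn_mod_dvd ?(ltnW p1) // subn1 => lp1.
have := dvdn_gcd l M p.-1; rewrite lM lp1 (eqP coM) dvdn1 => /eqP l1'.
by rewrite l1' in l_pr.
Qed.

Lemma expn_1_mod_pred p i : 0 < p -> p ^ i = 1 %[mod p.-1].
Proof.
move=> p0; rewrite -modnXm -{1}(prednK p0) -addn1 -[p.-1 + 1]addnC modnDr.
by rewrite modnXm exp1n.
Qed.

Lemma coprime_mod_eq a b m : a = b %[mod m] -> coprime a m = coprime b m.
Proof. by move=> eqab; rewrite -(coprime_modl a) eqab coprime_modl. Qed.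

(** * Sums of the digits in base $p$ *)

(** Digits beyond the length of $m$ vanish, so the upper limit of the sum may be
    chosen to suit an induction on the number of digits. *)
Lemma p_weight_wide p m N : 1 < p -> m < p ^ N ->
  p_weight p m = \sum_(s < N) (m %/ p ^ s) %% p.
Proof.
move=> p1 mN.
have wide A B : A <= B -> m < p ^ A ->
    \sum_(s < A) (m %/ p ^ s) %% p = \sum_(s < B) (m %/ p ^ s) %% p.
  move=> AB mA; rewrite (big_ord_widen _ (fun s => (m %/ p ^ s) %% p) AB).
  rewrite big_mkcond; apply: eq_bigr => s _; case: ltnP => // As.
  by rewrite divn_small ?mod0n // (leq_trans mA) // leq_exp2l.
rewrite /p_weight; case: (leqP m N) => mN'.
  by rewrite (wide m N) // ltn_expl.
by rewrite (wide N m) // ltnW.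
Qed.

Lemma p_weight_cons p m c : 1 < p -> c < p ->
  p_weight p (m * p + c) = p_weight p m + c.
Proof.
move=> p1 cp; have p0 := ltnW p1.
have mp : m * p + c < p ^ m.+1.
  apply: (@leq_trans (m.+1 * p)); first by rewrite mulSnr ltn_add2l.
  by rewrite expnSr leq_mul2r ltn_expl ?orbT.
rewrite (p_weight_wide _ _ _ p1 mp) (p_weight_wide _ _ _ p1 (ltn_expl m p1)).
rewrite big_ord_recl /= divn1 modnMDl modn_small // addnC; congr (_ + _).
apply: eq_bigr => s _; rewrite /bump /= add1n expnS divnMA.
by rewrite divnMDl // (divn_small cp) addn0.
Qed.

Lemma p_weight_mul_expn p i m : 1 < p -> p_weight p (m * p ^ i) = p_weight p m.
Proof.
move=> p1; elim: i => [|i IH]; first by rewrite muln1.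
by rewrite expnSr mulnA -[_ * p]addn0 p_weight_cons ?addn0 // ltnW.
Qed.

Lemma p_weight_shift p i m c : 1 < p -> 0 < i -> c < p ->
  p_weight p (m * p ^ i + c) = p_weight p m + c.
Proof.
case: i => // i p1 _ cp.
by rewrite expnSr mulnA p_weight_cons // p_weight_mul_expn.
Qed.

Lemma p_weight_digit p c : 1 < p -> c < p -> p_weight p c = c.
Proof.
move=> p1 cp; rewrite -[c in LHS]add0n -(mul0n p) p_weight_cons //.
by rewrite /p_weight big_ord0.
Qed.

(** * Powers in a finite field *)

Section PowerSums.
Local Open Scope ring_scope.
Import GRing.Theory.
Variable K : finFieldType.

Lemma expf_card_pred (x : K) : x != 0 -> x ^+ #|K|.-1 = 1.
Proof.
move=> x0; apply: (mulfI x0).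
by rewrite mulr1 -exprS prednK ?expf_card // (cardD1 0).
Qed.

(** Otherwise $X^t - 1$ would have $|K|-1 > t$ roots. *)
Lemma exists_expf_neq1 t :
  (0 < t < #|K|.-1)%N -> exists2 c : K, c != 0 & c ^+ t != 1.
Proof.
case/andP=> t0 tK; apply/exists_inP; rewrite -negb_forall_in.
apply/negP=> /forall_inP all1.
have nz : 'X^t - 1%:P != 0 :> {poly K} by rewrite -size_poly_gt0 size_XnsubC.
have := @max_poly_roots _ _ (enum [pred x : K | x != 0]) nz.
rewrite enum_uniq size_XnsubC // -cardE (cardC1 (0 : K)) ltnS leqNgt tK /=.
move=> H; suff: false by []; apply: H => //.
apply/allP=> x; rewrite mem_enum inE => x0.
by rewrite rootE !hornerE (eqP (all1 x x0)) subrr.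
Qed.

Lemma natr_card : #|K|%:R = 0 :> K.
Proof.
apply: (addrI (\sum_(x : K) x)); rewrite addr0 -sumr_const -big_split /=.
by rewrite [RHS](reindex_inj (addIr 1)).
Qed.

(** If $|K|-1$ does not divide $t$, some $c \ne 0$ has $c^t \ne 1$, and the
    substitution $x \mapsto cx$ multiplies the sum by $c^t$.  Otherwise every
    nonzero $x$ contributes $1$. *)
Lemma sum_expf t : (0 < t)%N ->
  \sum_(x : K) x ^+ t = if (#|K|.-1 %| t)%N then -1 else 0.
Proof.
move=> t0; have K1 : (0 < #|K|)%N by rewrite (cardD1 0).
have K2 : (0 < #|K|.-1)%N by rewrite -ltnS prednK // finNzRing_gt1.
case: ifPn => [/dvdnP[r def_t] | ndvd].
  rewrite (bigD1 0) //= expr0n gtn_eqF // add0r.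
  rewrite (eq_bigr (fun=> 1)); last first.
    by move=> x x0; rewrite def_t mulnC exprM expf_card_pred // expr1n.
  rewrite sumr_const (cardC1 (0 : K)); apply: (addrI 1).
  by rewrite subrr -mulrS prednK // natr_card.
have [|c c0 ct] := @exists_expf_neq1 (t %% #|K|.-1).
  by rewrite lt0n ndvd ltn_mod.
have {}ct : c ^+ t != 1.
  rewrite (divn_eq t #|K|.-1) exprD mulnC exprM expf_card_pred //.
  by rewrite expr1n mul1r.
have : (c ^+ t - 1) * \sum_(x : K) x ^+ t = 0.
  rewrite mulrBl mul1r mulr_sumr; apply/eqP; rewrite subr_eq0; apply/eqP.
  rewrite [RHS](reindex_inj (mulfI c0)) /=.
  by apply: eq_bigr => x _; rewrite exprMn.
by move/eqP; rewrite mulf_eq0 subr_eq0 (negbTE ct) => /eqP.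
Qed.
(** A Bezout relation $aM = b(|K|-1) + 1$ makes $x \mapsto x^a$ a left
    inverse. *)
Lemma expf_inj_coprime M : (0 < M)%N -> coprime M #|K|.-1 ->
  injective (fun x : K => x ^+ M).
Proof.
move=> M0 /eqP co; have [km kn + _] := egcdnP #|K|.-1 M0; rewrite co => bez.
apply: (can_inj (g := fun x => x ^+ km)) => x.
rewrite -exprM mulnC bez addn1 exprS.
have [-> | x0] := eqVneq x 0; first by rewrite mul0r.
by rewrite mulnC exprM expf_card_pred // expr1n mulr1.
Qed.

End PowerSums.

(** * Polynomials summed over the prime subfield *)

Section XaddC.
Local Open Scope ring_scope.
Import GRing.Theory.
Variable R : comNzRingType.

Lemma coef_XaddC_exp (w : R) k s :
  (('X + w%:P) ^+ k)`_s = w ^+ (k - s) *+ 'C(k, s).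
Proof.
have -> : ('X + w%:P) ^+ k = \poly_(j < k.+1) (w ^+ (k - j) *+ 'C(k, j)).
  rewrite poly_def addrC exprDn; apply: eq_bigr => j _.
  by rewrite -polyC_exp mul_polyC scalerMnl.
by rewrite coef_poly; case: ltnP => // /bin_small ->; rewrite mulr0n.
Qed.

Lemma size_XaddC_exp (w : R) k : size (('X + w%:P) ^+ k) = k.+1.
Proof. by rewrite -[w]opprK polyCN size_exp_XsubC. Qed.

End XaddC.

Section PrimeSubfield.
Local Open Scope ring_scope.
Import GRing.Theory.
Variables (p : nat) (F : finFieldType).
Hypothesis charF : p \in [pchar F].

Let p_pr : prime p := pcharf_prime charF.
Local Notation emb := (@Fp_embed p F).

Lemma Fp_embed0 : emb 0 = 0. Proof. by []. Qed.

Lemma Fp_embed_nat (n : nat) : emb n%:R = n%:R.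
Proof. by rewrite /Fp_embed val_Fp_nat // (GRing.natr_mod_pchar charF). Qed.

Lemma Fp_embedD : {morph emb : x y / x + y}.
Proof.
move=> x y; rewrite -[in LHS](natr_Zp x) -[in LHS](natr_Zp y) -natrD.
by rewrite Fp_embed_nat natrD.
Qed.

Lemma Fp_embedM : {morph emb : x y / x * y}.
Proof.
move=> x y; rewrite -[in LHS](natr_Zp x) -[in LHS](natr_Zp y) -natrM.
by rewrite Fp_embed_nat natrM.
Qed.

Lemma Fp_embed1 : emb 1 = 1.
Proof. exact: (Fp_embed_nat 1). Qed.

Lemma Fp_embedX c n : emb (c ^+ n) = emb c ^+ n.
Proof.
by elim: n => [|n IH]; rewrite ?Fp_embed1 // !exprS Fp_embedM IH.
Qed.

Lemma Fp_embed_inj : injective emb.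
Proof.
move=> x y /eqP eqxy; apply/eqP; rewrite -subr_eq0.
apply/negP => /negP d0.
have exy : emb (x - y) = 0.
  by apply: (addIr (emb y)); rewrite -Fp_embedD subrK add0r; apply/eqP.
have /eqP := Fp_embed1; rewrite -(divff d0) Fp_embedM exy mul0r eq_sym.
by rewrite oner_eq0.
Qed.

Lemma Fp_embed_expp c i : emb c ^+ (p ^ i) = emb c.
Proof.
elim: i => [|i IH]; first by rewrite expr1.
by rewrite expnSr exprM IH -Fp_embedX -{2}(expf_card c) card_Fp.
Qed.

Lemma exprD_pchar i (x y : F) :
  (x + y) ^+ (p ^ i) = x ^+ (p ^ i) + y ^+ (p ^ i).
Proof.
apply: exprDn_pchar.
by rewrite (eq_pnat _ (pcharf_eq charF)) pnatX pnat_id.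
Qed.

(** For $t = 0$ the sum is $p = 0$, although $p-1$ divides $t$; this is why only
    the exponents $p-1$ and $2(p-1)$ survive. *)
Lemma sum_Fp_embedX t : (t <= (p.-1).*2)%N ->
  \sum_(c : 'F_p) emb c ^+ t = - ((t == p.-1) || (t == p.-1.*2))%:R.
Proof.
have p1 : (0 < p.-1)%N by rewrite -ltnS prednK ?prime_gt0 ?prime_gt1.
case: (posnP t) => [-> _ | t0 tp].
  under eq_bigr do rewrite expr0.
  rewrite sumr_const card_Fp // (pcharf0 charF).
  by rewrite !ltn_eqF ?double_gt0 // oppr0.
have -> : \sum_(c : 'F_p) emb c ^+ t = emb (\sum_(c : 'F_p) c ^+ t).
  rewrite (big_morph emb Fp_embedD Fp_embed0).
  by apply: eq_bigr => c _; rewrite -Fp_embedX.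
rewrite sum_expf // card_Fp //.
have -> : (t == p.-1) || (t == p.-1.*2) = (p.-1 %| t)%N.
  apply/idP/idP => [/orP[] /eqP -> // | /dvdnP[r def_t]].
    by rewrite -muln2 dvdn_mulr.
  have : (r <= 2)%N by rewrite -(leq_pmul2r p1) -def_t mul2n.
  case: r def_t => [|[|[|r]]] // def_t _; first by rewrite def_t in t0.
    by rewrite def_t mul1n eqxx.
  by rewrite def_t mul2n eqxx orbT.
case: ifP => _; rewrite ?oppr0 //.
apply: (addrI (emb 1)); rewrite -Fp_embedD subrr Fp_embed0.
by rewrite Fp_embed1 subrr.
Qed.

(** By Taylor expansion at $x$ and the values of the power sums, the left-hand
    side is minus the sum of the Hasse derivatives of $P$ of orders $p-1$ and
    $2(p-1)$ at $x$.  Both are constant polynomials: the coefficient of $X^j$ in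
    the first is $\binom{p-1+j}{p-1}$ times a coefficient of $P$, where the
    binomial vanishes modulo $p$ for $0 < j \le p-1$, and the other positive
    coefficients lie beyond the degree of $P$. *)
Lemma sum_horner_Fp (P : {poly F}) (x : F) : (size P <= (p.-1.*2).+1)%N ->
  \sum_(c : 'F_p) P.[x + emb c] = - (P`_p.-1 + P`_(p.-1.*2)).
Proof.
have p1 : (0 < p.-1)%N by rewrite -ltnS prednK ?prime_gt0 ?prime_gt1.
move=> sP.
have taylor (c : 'F_p) :
    P.[x + emb c] = \sum_(t < (p.-1.*2).+1) P^`N(t).[x] * emb c ^+ t.
  rewrite nderiv_taylor; last exact: mulrC.
  rewrite (big_ord_widen _ (fun t => P^`N(t).[x] * emb c ^+ t) sP) big_mkcond.
  apply: eq_bigr => t _; case: ltnP => // le_t.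
  suff -> : P^`N(t) = 0 by rewrite horner0 mul0r.
  apply/polyP=> j; rewrite coef_nderivn coef0 nth_default ?mul0rn //.
  by rewrite (leq_trans le_t) ?leq_addr.
under eq_bigr do rewrite taylor.
rewrite exchange_big /=.
under eq_bigr => t _
  do rewrite -mulr_sumr sum_Fp_embedX ?(ltnSE (ltn_ord t)) //.
have lt1 : (p.-1 < (p.-1.*2).+1)%N by rewrite ltnS -addnn leq_addr.
rewrite (bigD1 (Ordinal lt1)) //= (bigD1 ord_max) /=; last first.
  by rewrite -val_eqE /= gtn_eqF // -addnn -[ltnLHS]addn0 ltn_add2l.
rewrite big1 ?addr0; last first.
  move=> t /andP[]; rewrite -!val_eqE /= => /negbTE -> /negbTE ->.
  by rewrite oppr0 mulr0.
rewrite !eqxx orbT /= !mulrN1 opprD; congr (- _ - _).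
  have -> : P^`N(p.-1) = (P`_p.-1)%:P.
    apply/polyP=> -[|j]; rewrite coef_nderivn coefC /=.
      by rewrite addn0 binn.
    case: (leqP j.+1 p.-1) => jp.
      rewrite -mulr_natr; apply/eqP; rewrite mulf_eq0 orbC.
      by rewrite -(dvdn_pcharf charF) prime_dvd_bin_pred.
    by rewrite nth_default ?mul0rn // (leq_trans sP) // -addnn -addnS leq_add2l.
  by rewrite hornerC.
have -> : P^`N(p.-1.*2) = (P`_(p.-1.*2))%:P.
  apply/polyP=> -[|j]; rewrite coef_nderivn coefC /=.
    by rewrite addn0 binn.
  by rewrite nth_default ?mul0rn // (leq_trans sP) // addnS ltnS leq_addr.
by rewrite hornerC.
Qed.

Definition Fp_sum d (y : F) := \sum_(c : 'F_p) (y + emb c) ^+ d.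

(** Here $P = (X + w)^{k_2} X^{k_1}$ with $w = y^{p^i} - y$, evaluated at the
    points $y + c$.  For $k_1 + k_2 \le p-1$ the truncated exponent
    $k_2 - (p-1-k_1)$ is $0$, so the formula then exhibits a constant. *)
Lemma Fp_sum_2digits i k1 k2 y : (k1 <= p.-1)%N -> (k2 <= p.-1)%N ->
  Fp_sum (k2 * p ^ i + k1) y =
    - ((y ^+ (p ^ i) - y) ^+ (k2 - (p.-1 - k1)) *+ 'C(k2, p.-1 - k1))
    - 'C(k2, p.-1.*2 - k1)%:R.
Proof.
move=> le1 le2; pose w := y ^+ (p ^ i) - y.
pose P := ('X + w%:P) ^+ k2 * 'X^k1.
have sP : (size P <= (p.-1.*2).+1)%N.
  rewrite (leq_trans (size_polyMleq _ _)) // size_XaddC_exp size_polyXn.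
  by rewrite addnS -addnn ltnS leq_add.
have -> : Fp_sum (k2 * p ^ i + k1) y = \sum_(c : 'F_p) P.[y + emb c].
  apply: eq_bigr => c _; rewrite exprD mulnC exprM exprD_pchar Fp_embed_expp.
  rewrite !hornerE; congr (_ ^+ _ * _).
  by rewrite /= (addrC y) [RHS]addrAC addrK addrC.
have le3 : (k1 <= p.-1.*2)%N by rewrite (leq_trans le1) // -addnn leq_addr.
rewrite sum_horner_Fp // !coefMXn !ltnNge le1 le3 /= !coef_XaddC_exp opprD.
(* $2(p-1)$ is at least the degree of P, so its coefficient is free of w. *)
suff -> : (k2 - (p.-1.*2 - k1) = 0)%N by rewrite expr0.
by apply/eqP; rewrite subn_eq0 leq_subRL // -addnn leq_add.
Qed.

(** The base point $t = y^{p^i}$ turns the digit $p-1$ into the factor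
    $X^{p-1}$.  The other two factors form
    $Q = (X + z^{p^i})^{k_2}(X - z)^{k_1}$ with $z = t - y$, and since
    $\deg Q < p-1$ only the constant term $Q(0)$ contributes. *)
Lemma Fp_sum_3digits i k1 k2 y : (k1 + k2 < p.-1)%N ->
  Fp_sum (k2 * p ^ (2 * i) + p.-1 * p ^ i + k1) y =
    - (-1) ^+ k1 * (y ^+ (p ^ i) - y) ^+ (k2 * p ^ i + k1).
Proof.
move=> lt12; pose z := y ^+ (p ^ i) - y.
pose Q := ('X + (z ^+ (p ^ i))%:P) ^+ k2 * ('X + (- z)%:P) ^+ k1.
have sQ : (size Q <= p.-1)%N.
  rewrite (leq_trans (size_polyMleq _ _)) // !size_XaddC_exp.
  by rewrite addnS addSn addnC.
pose P := Q * 'X^(p.-1).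
have sP : (size P <= (p.-1.*2).+1)%N.
  rewrite (leq_trans (size_polyMleq _ _)) // size_polyXn addnS -addnn /=.
  by rewrite leqW // leq_add2r.
have -> : Fp_sum (k2 * p ^ (2 * i) + p.-1 * p ^ i + k1) y =
    \sum_(c : 'F_p) P.[y ^+ (p ^ i) + emb c].
  apply: eq_bigr => c _; rewrite !exprD ![(_ * p ^ _)%N]mulnC !exprM.
  rewrite !exprD_pchar !Fp_embed_expp.
  rewrite !hornerE mulrAC; congr (_ ^+ _ * _ ^+ _ * _).
    by rewrite [RHS]addrC addrA -exprD_pchar subrK mul2n -addnn expnD exprM.
  by rewrite /z opprB [RHS]addrC addrA subrK.
rewrite sum_horner_Fp // !coefMXn ltnn subnn ltnNge -addnn leq_addr /= addnK.
rewrite [Q`_p.-1]nth_default // addr0.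
rewrite -horner_coef0 !hornerE.
by rewrite [(- z) ^+ _]exprNn -/z exprD (mulnC k2) exprM mulNr mulrCA.
Qed.

Lemma induced_Xn d x : @induced p F 'X^d x = x ^+ d :> F.
Proof.
rewrite /induced (_ : map_poly emb 'X^d = 'X^d) ?hornerXn //.
apply/polyP=> j; rewrite coef_map_id0 // !coefXn.
by case: eqP; rewrite ?Fp_embed1.
Qed.

Lemma Fp_sum_scale d (a x : F) : a != 0 ->
  \sum_(c : 'F_p) @induced p F 'X^d (x + emb c * a) = a ^+ d * Fp_sum d (x / a).
Proof.
move=> a0; rewrite /Fp_sum mulr_sumr; apply: eq_bigr => c _.
by rewrite induced_Xn -exprMn mulrDr [a * (x / a)]mulrC divfK // [a * _]mulrC.
Qed.

Lemma GAPN_XnP d : GAPN p (@induced p F 'X^d) <->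
  forall b : F, (#|[set y | Fp_sum d y == b]| <= p)%N.
Proof.
split=> [gapn b | fib a b a0].
  apply: leq_trans (gapn 1 b (oner_neq0 _)); apply: subset_leq_card.
  apply/subsetP=> y; rewrite !inE Fp_sum_scale ?oner_neq0 //.
  by rewrite expr1n mul1r divr1.
apply: leq_trans (fib (b / a ^+ d)).
rewrite -(card_imset _ (mulIf (invr_neq0 a0))).
apply: subset_leq_card; apply/subsetP=> _ /imsetP[x + ->].
rewrite !inE Fp_sum_scale // => /eqP <-.
by rewrite [_ * Fp_sum _ _]mulrC mulfK // expf_neq0.
Qed.

Lemma Fp_sum_translate d c y : Fp_sum d (y + emb c) = Fp_sum d y.
Proof.
rewrite /Fp_sum [RHS](reindex_inj (addrI c)) /=.
by apply: eq_bigr => j _; rewrite Fp_embedD addrA.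
Qed.

Lemma Fp_sum_dilate d z y : z != 0 ->
  Fp_sum d (emb z * y) = emb z ^+ d * Fp_sum d y.
Proof.
move=> z0; rewrite /Fp_sum mulr_sumr [LHS](reindex_inj (mulfI z0)) /=.
by apply: eq_bigr => j _; rewrite Fp_embedM -mulrDr exprMn.
Qed.

Lemma exists_notin_Fp : (p < #|F|)%N -> exists y, y \notin codom emb.
Proof.
move=> big; apply/existsP; rewrite -negb_forall; apply/negP => /forallP all_im.
move: big; apply/negP; rewrite -leqNgt -[leqRHS](card_Fp p_pr).
rewrite -(card_codom Fp_embed_inj).
by apply: subset_leq_card; apply/subsetP=> y _; apply: all_im.
Qed.

Lemma frob_fix_iter (x : F) a k : x ^+ (p ^ a) = x -> x ^+ (p ^ (k * a)) = x.
Proof.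
move=> xa; elim: k => [|k IH]; first by rewrite expr1.
by rewrite mulSn expnD exprM xa.
Qed.

(** $x$ is fixed by the powers $i$ and $n$ of the Frobenius map, hence by the
    power $\gcd(i, n) = 1$. *)
Lemma frob_fix_coprime (x : F) i n : #|F| = (p ^ n)%N -> (0 < i)%N ->
  coprime i n -> x ^+ (p ^ i) = x -> x ^+ p = x.
Proof.
move=> cF i0 /eqP co xi; have [km kn + _] := egcdnP n i0; rewrite co => bez.
rewrite -[RHS](frob_fix_iter _ _ km xi) bez expnD exprM frob_fix_iter //.
by rewrite -cF expf_card.
Qed.

(** Points of one fibre share the value of $y^{p^i} - y$, so they differ by an
    element fixed by $x \mapsto x^{p^i}$, hence by $x \mapsto x^p$.  The fibre
    through $y_0$ thus consists of roots of $X^p - X - (y_0^p - y_0)$. *)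
Lemma GAPN_of_Fp_sum n i M d (al be : F) : #|F| = (p ^ n)%N -> (0 < i)%N ->
    coprime i n -> (0 < M)%N -> coprime M (p ^ n).-1 -> al != 0 ->
    (forall y, Fp_sum d y = al * (y ^+ (p ^ i) - y) ^+ M + be) ->
  GAPN p (@induced p F 'X^d).
Proof.
move=> cF i0 co M0 coM al0 sumE; apply/GAPN_XnP => b.
have [-> | [y0]] := set_0Vmem [set y | Fp_sum d y == b].
  by rewrite cards0.
rewrite inE sumE => /eqP <-.
set A := [set y | _]; pose q := 'X^p - 'X - (y0 ^+ p - y0)%:P : {poly F}.
have p1 := prime_gt1 p_pr.
have sq : size q = p.+1.
  rewrite /q -addrA size_polyDl size_polyXn // ltnS.
  rewrite (leq_trans (size_polyD _ _)) // geq_max !size_polyN size_polyX p1.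
  by rewrite (leq_trans (size_polyC_leq1 _)) // ltnW.
rewrite -ltnS -sq cardE; apply: max_poly_roots; rewrite ?enum_uniq //.
  by rewrite -size_poly_gt0 sq.
apply/allP=> y; rewrite mem_enum inE sumE => /eqP /addIr /(mulfI al0).
rewrite -cF in coM; move/(expf_inj_coprime _ _ M0 coM) => eqz.
have : (y - y0) ^+ (p ^ i) = y - y0.
  apply: (addIr (y0 ^+ (p ^ i))); rewrite -exprD_pchar subrK.
  by rewrite -[RHS]addrA [- y0 + _]addrC -eqz addrC subrK.
move/(frob_fix_coprime _ _ _ cF i0 co) => eqd.
have : y ^+ p = (y - y0) + y0 ^+ p.
  by rewrite -[in RHS]eqd -(expn1 p) -exprD_pchar subrK.
by move=> yp; rewrite rootE !hornerE yp; apply/eqP; ring.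
Qed.

(** $S_d$ takes the same value at $y + c$ and, when $\zeta^d = 1$, at $\zeta y$.
    If $\zeta y = y + c$ with $\zeta \ne 1$, then $y = c/(\zeta - 1)$ lies in
    $F_p$; any other $y$ gives a fibre with $p+1$ elements. *)
Lemma GAPN_monomial_coprime d : (p < #|F|)%N ->
  GAPN p (@induced p F 'X^d) -> coprime d p.-1.
Proof.
move=> ltpF /GAPN_XnP gapn; apply/negPn/negP => ncop.
have p1 : (0 < p.-1)%N by rewrite -ltnS prednK ?prime_gt0 ?prime_gt1.
have g1 : (1 < gcdn d p.-1)%N.
  by rewrite ltn_neqAle eq_sym ncop gcdn_gt0 p1 orbT.
(* $\zeta = c^{(p-1)/\gcd(d,p-1)}$ is a $d$-th root of unity. *)
have [|c c0 c1] := @exists_expf_neq1 'F_p (p.-1 %/ gcdn d p.-1).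
  rewrite card_Fp //; apply/andP; split; last exact: ltn_Pdiv.
  by rewrite divn_gt0 ?(ltnW g1) // dvdn_leq ?dvdn_gcdr.
pose z : 'F_p := c ^+ (p.-1 %/ gcdn d p.-1).
have z0 : z != 0 by rewrite expf_neq0.
have zd : z ^+ d = 1.
  rewrite -exprM mulnC muln_divCA_gcd exprM.
  have : c ^+ #|'F_p|.-1 = 1 by apply: expf_card_pred.
  by rewrite card_Fp // => ->; rewrite expr1n.
have [y yFp] := exists_notin_Fp ltpF.
have := gapn (Fp_sum d y); rewrite leqNgt => /negP; apply.
pose A := (emb z * y) |: [set y + emb j | j : 'F_p].
apply: (@leq_trans #|A|); last first.
  apply: subset_leq_card; apply/subsetP=> x; rewrite !inE => /orP[/eqP -> |].
    by rewrite Fp_sum_dilate // -Fp_embedX zd Fp_embed1 mul1r.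
  by case/imsetP=> j _ ->; rewrite Fp_sum_translate.
rewrite cardsU1 card_imset; last by move=> j k /addrI /Fp_embed_inj.
rewrite card_Fp // (_ : _ \notin _) //; apply/imsetP=> -[j _ eqzy].
have ez : emb (z - 1) != 0.
  by rewrite -Fp_embed0 (inj_eq Fp_embed_inj) subr_eq0.
move/negP: yFp; apply; apply/codomP; exists (j / (z - 1)).
apply: (mulfI ez); rewrite -Fp_embedM mulrCA divff ?subr_eq0 // mulr1.
apply: (addrI y); rewrite -eqzy -{1}[y]mul1r -Fp_embed1 -mulrDl -Fp_embedD.
by rewrite addrC subrK.
Qed.

End PrimeSubfield.

(** * Exceptionality of monomials *)

(** Every prime $n > N + i + M$ works: it is prime to $i$, and $M$ is prime to
    $p^n - 1$ by [coprime_pred_expn]. *)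
Lemma p_exceptional_of_Fp_sum p i M d : prime p -> 0 < i -> 0 < M ->
    coprime M p.-1 ->
    (forall F : finFieldType, (p \in [pchar F])%R -> exists al be : F,
      al != 0%R /\
      forall y, Fp_sum p F d y = (al * (y ^+ (p ^ i) - y) ^+ M + be)%R) ->
  p_exceptional_GAPN ('X^d : {poly 'F_p})%R.
Proof.
move=> p_pr i0 M0 coM sumE N.
have [n lt_n n_pr] := prime_above (N + i + M).
exists n; first by rewrite (leq_ltn_trans _ lt_n) // -addnA leq_addr.
move=> F cF; have charF := card_finPcharP cF p_pr.
have [al [be [al0 {}sumE]]] := sumE F charF.
apply: (@GAPN_of_Fp_sum p F charF n i M d al be) => //.
  rewrite coprime_sym prime_coprime // gtnNdvd //.
  by rewrite (leq_ltn_trans _ lt_n) // -addnA addnCA leq_addr.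
apply: coprime_pred_expn; rewrite ?prime_gt1 // M0.
by rewrite (leq_trans _ (ltnW lt_n)) // leq_addl.
Qed.

Lemma p_exceptional_field p (f : {poly 'F_p}) : prime p ->
  p_exceptional_GAPN f ->
  exists F : finFieldType,
    [/\ (p \in [pchar F])%R, p < #|F| & GAPN p (@induced p F f)].
Proof.
move=> p_pr /(_ 1) [n n1 gapn].
have [F charF cF] := pPrimePowerField p_pr (ltnW n1).
exists F; split=> //; last exact: gapn.
by rewrite cF -[ltnLHS]expn1 ltn_exp2l // prime_gt1.
Qed.

Theorem proposition2p4 (p i k1 k2 d2 d3 : nat)
    (hp : prime p) (hodd : odd p) (hi : 0 < i)
    (hk1 : 1 <= k1 <= p - 1) (hk2 : 1 <= k2 <= p - 1)
    (hd2 : d2 = k2 * p ^ i + k1)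
    (hd3 : d3 = k2 * p ^ (2 * i) + (p - 1) * p ^ i + k1) :
  (p_exceptional_GAPN ('X^d2 : {poly 'F_p})%R <->
     p <= p_weight p d2 /\ gcdn d2 (p - 1) = 1) /\
  (p_weight p d3 < 2 * (p - 1) -> gcdn d3 (p - 1) = 1 ->
     p_exceptional_GAPN ('X^d3 : {poly 'F_p})%R).
Proof.
have p0 := prime_gt0 hp; have p1 := prime_gt1 hp.
rewrite subn1 in hk1 hk2 hd3 *.
case/andP: hk1 => k1_gt0 le_k1; case/andP: hk2 => k2_gt0 le_k2.
have lt_k1 : k1 < p by rewrite -(prednK p0).
have lt_k2 : k2 < p by rewrite -(prednK p0).
have pmod j : p ^ j = 1 %[mod p.-1] by apply: expn_1_mod_pred.
have coE : coprime (k2 * p ^ i + k1) p.-1 = coprime (k1 + k2) p.-1.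
  apply: coprime_mod_eq; rewrite -modnDml -modnMmr pmod modnMmr muln1 modnDml.
  by rewrite addnC.
split; last first.
  have -> : d3 = (k2 * p ^ i + p.-1) * p ^ i + k1.
    by rewrite hd3 mulnDl -mulnA -expnD addnn -mul2n.
  rewrite !p_weight_shift ?ltn_predL // p_weight_digit // => wt co3.
  have lt12 : k1 + k2 < p.-1.
    rewrite -(ltn_add2r p.-1) addnn -mul2n (leq_trans _ wt) // ltnS.
    by rewrite (addnC k1) addnAC.
  apply: (@p_exceptional_of_Fp_sum p i (k2 * p ^ i + k1)) => //.
  - by rewrite addn_gt0 k1_gt0 orbT.
  - rewrite coE; move/eqP: co3; rewrite -/(coprime _ _).
    suff /coprime_mod_eq -> :
      (k2 * p ^ i + p.-1) * p ^ i + k1 = k1 + k2 %[mod p.-1] by [].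
    rewrite -modnDml -modnMmr pmod modnMmr muln1 -modnDml modnDr modnDml.
    by rewrite -modnMmr pmod modnMmr muln1 modnDml addnC.
  move=> F charF; exists (- (-1) ^+ k1)%R, 0%R; split.
    by rewrite GRing.oppr_eq0 GRing.signr_eq0.
  move=> y; rewrite GRing.addr0 -Fp_sum_3digits //.
  by rewrite mulnDl -mulnA -expnD addnn -mul2n.
rewrite hd2 p_weight_shift // p_weight_digit // (addnC k2).
split=> [exc | [wt /eqP]].
  have [F [charF ltpF gapn]] := p_exceptional_field _ _ hp exc.
  split; last by apply/eqP; apply: GAPN_monomial_coprime gapn.
  rewrite leqNgt; apply/negP => small.
  (* $S_{d_2}$ is constant, and its only fibre is the whole field. *)
  have le12 : k2 - (p.-1 - k1) = 0.
    by apply/eqP; rewrite subn_eq0 leq_subRL // -ltnS prednK.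
  have := (GAPN_XnP _ _ charF _).1 gapn (Fp_sum p F (k2 * p ^ i + k1) 0%R).
  rewrite leqNgt => /negP; apply.
  apply: leq_trans ltpF _; apply: subset_leq_card; apply/subsetP=> y _.
  by rewrite inE !Fp_sum_2digits // le12 !GRing.expr0.
rewrite -/(coprime _ _) coE => co.
pose M := k2 - (p.-1 - k1).
have le12 : p.-1 - k1 <= k2.
  by rewrite leq_subLR (leq_trans _ wt) // leq_pred.
have defM : k1 + k2 = M + p.-1.
  by rewrite -{1}(subnK le12) addnCA subnKC.
apply: (@p_exceptional_of_Fp_sum p i M) => //.
- by rewrite -(ltn_add2r p.-1) -defM add0n prednK.
- by rewrite -(coprime_mod_eq _ _ _ (_ : k1 + k2 = M %[mod _])) // defM modnDr.
move=> F charF.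
exists (- 'C(k2, p.-1 - k1)%:R)%R, (- 'C(k2, p.-1.*2 - k1)%:R)%R; split.
  by rewrite GRing.oppr_eq0 -(GRing.dvdn_pcharf charF) prime_ndvd_bin ?le12.
by move=> y; rewrite Fp_sum_2digits // GRing.mulNr GRing.mulr_natl.
Qed.
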